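(* Let $n\ge 8$ be an integer. For positive integers $x$ put $f_n(x)=\dfrac{n(n-1)}{2x}$ and $g_n(x)=(x+1)\left(n-x-\tfrac12\right)$. Then $$\psi'_c(K_n)\le \left\lfloor \max\left\{\min\{f_n(x),g_n(x)\} : x\in\mathbb{N}\right\}\right\rfloor ,$$ where $\mathbb{N}$ denotes the set of positive integers.
   Context: $K_n$ is the complete graph on $n$ vertices and $[k]=\{1,\dots,k\}$. For a finite simple graph $H$, a complete $k$-coloring of $H$ is a (not necessarily proper) map $\varsigma\colon V(H)\to[k]$ such that for each pair of different colors $i,j\in[k]$ there is an edge $xy\in E(H)$ with $x\in\varsigma^{-1}(i)$ and $y\in\varsigma^{-1}(j)$. It is connected if each color class $\varsigma^{-1}(i)$ induces a connected subgraph of $H$. For a connected graph $H$, $\psi_c(H)$ is the largest $k$ for which $H$ has a connected and complete $k$-coloring. The connected-pseudoachromatic index of a graph $G$ is $\psi'_c(G)=\psi_c(L(G))$, where $L(G)$ is the line graph of $G$. Equivalently, $\psi'_c(K_n)$ is the largest $k$ for which the edges of $K_n$ can be colored with $k$ colors so that each color class of edges forms a connected subgraph and every two color classes share at least one vertex. *)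

(* Defs.v *)
From HB Require Import structures.
From mathcomp Require Import all_boot all_order all_algebra.

Set Implicit Arguments.
Unset Strict Implicit.
Unset Printing Implicit Defensive.

Import Order.TTheory GRing.Theory Num.Theory.

Record sgraph := SGraph {
  vertex :> finType;
  adj : rel vertex;
  adj_sym : symmetric adj;
  adj_irr : irreflexive adj }.

Definition neq_rel (n : nat) : rel 'I_n := fun x y => x != y.

Lemma neq_rel_sym n : symmetric (@neq_rel n).
Proof. by move=> x y; rewrite /neq_rel eq_sym. Qed.

Lemma neq_rel_irr n : irreflexive (@neq_rel n).
Proof. by move=> x; rewrite /neq_rel eqxx. Qed.

Definition complete_graph (n : nat) : sgraph :=
  SGraph (@neq_rel_sym n) (@neq_rel_irr n).

Definition edges (G : sgraph) : {set {set G}} :=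
  [set [set p.1; p.2] | p in [set p : G * G | adj p.1 p.2]].

Definition line_adj (G : sgraph) : rel {e : {set G} | e \in edges G} :=
  fun e f => (e != f) && (val e :&: val f != set0).

Lemma line_adj_sym G : symmetric (@line_adj G).
Proof. by move=> e f; rewrite /line_adj eq_sym setIC. Qed.

Lemma line_adj_irr G : irreflexive (@line_adj G).
Proof. by move=> e; rewrite /line_adj eqxx. Qed.

Definition line_graph (G : sgraph) : sgraph :=
  SGraph (@line_adj_sym G) (@line_adj_irr G).

(* [induces_connected S]: the subgraph of [H] induced by [S] is connected;
   the graph without vertices is not considered connected. *)
Definition induces_connected (H : sgraph) (S : {set H}) : bool :=
  (S != set0) &&
  [forall x in S, forall y in S,
     connect [rel u v : H | [&& u \in S, v \in S & adj u v]] x y].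

Definition is_complete_coloring (H : sgraph) (k : nat) (c : {ffun H -> 'I_k}) :
  bool :=
  [forall i, forall j, (i != j) ==>
     [exists x, exists y, [&& adj x y, c x == i & c y == j]]].

Definition is_connected_coloring (H : sgraph) (k : nat) (c : {ffun H -> 'I_k}) :
  bool :=
  [forall i, induces_connected [set x | c x == i]].

Definition has_connected_complete_coloring (H : sgraph) (k : nat) : bool :=
  [exists c : {ffun H -> 'I_k},
     is_connected_coloring c && is_complete_coloring c].

(* The largest [k] such that [H] has a connected and complete [k]-coloring.
   It is meaningful for connected [H] (see [psi_c_ub], [psi_c_attained]); a
   disconnected [H] may have no such coloring at all, and then it is 0. *)
Definition psi_c (H : sgraph) : nat :=
  \max_(k < #|H|.+1 | has_connected_complete_coloring H k) k.

Lemma connected_complete_coloring_card (H : sgraph) (k : nat) :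
  has_connected_complete_coloring H k -> k <= #|H|.
Proof.
case/existsP=> c /andP[/forallP conn _].
have surj i : exists x, c x == i.
  case/andP: (conn i) => /set0Pn[x]; rewrite inE => cx _; by exists x.
pose r i := xchoose (surj i).
have rK : cancel r c by move=> i; exact/eqP/(xchooseP (surj i)).
by rewrite -[k in k <= _]card_ord; exact: leq_card (can_inj rK).
Qed.

Lemma psi_c_ub (H : sgraph) (k : nat) :
  has_connected_complete_coloring H k -> k <= psi_c H.
Proof.
move=> Hk; have kH := connected_complete_coloring_card Hk.
rewrite -ltnS in kH.
exact: (@leq_bigmax_cond _ _ (fun i : 'I_#|H|.+1 => val i) (Ordinal kH) Hk).
Qed.

Lemma psi_c_attained (H : sgraph) :
  induces_connected [set: H] -> has_connected_complete_coloring H (psi_c H).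
Proof.
move=> connH.
have H1 : has_connected_complete_coloring H 1.
  apply/existsP; exists [ffun=> ord0]; apply/andP; split.
    apply/forallP=> i; suff -> : [set x : H | [ffun=> ord0] x == i] = setT by [].
    by apply/setP=> x; rewrite !inE [i]ord1 ffunE eqxx.
  by apply/forallP=> i; apply/forallP=> j; rewrite [i]ord1 [j]ord1 eqxx.
have lt1 : 1 < #|H|.+1 by rewrite ltnS (connected_complete_coloring_card H1).
have P1 : 0 < #|[pred k : 'I_#|H|.+1 | has_connected_complete_coloring H k]|.
  by apply/card_gt0P; exists (Ordinal lt1).
have [k Hk E] := eq_bigmax_cond (fun i : 'I_#|H|.+1 => val i) P1.
have -> : psi_c H = val k by rewrite -E; apply: eq_bigl.
exact: Hk.
Qed.

Definition connected_pseudoachromatic_index (G : sgraph) : nat :=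
  psi_c (line_graph G).

Local Open Scope ring_scope.

Definition f_ (n x : nat) : rat := (n%:R * (n%:R - 1)) / (2 * x%:R).

Definition g_ (n x : nat) : rat := (x%:R + 1) * (n%:R - x%:R - 1 / 2).

Definition is_max (A : rat -> Prop) (M : rat) : Prop :=
  A M /\ forall y, A y -> y <= M.

(* Main.v *)
Require Import Defs.
From mathcomp Require Import all_boot all_order all_algebra.
From mathcomp Require Import zify lra.

Import Order.TTheory GRing.Theory Num.Theory.

Set Implicit Arguments.
Unset Strict Implicit.

(** A connected and complete colouring of the line graph of [G] splits the
    edges of [G] into connected classes whose vertex sets, here called spans,
    pairwise intersect.  Let [V] be a smallest span, with [v] vertices, and let
    [n] be the order of [G].  Two counts bound the number [k] of colours.

    A connected class spanning [w] vertices has at least [w - 1] edges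
    ([card_span]), hence every class has at least [v - 1] of them and
    [k * (v - 1) <= 'C(n, 2)]: this is the bound [f_ n (v - 1)].

    Every class meets [V], so by connectedness it either lies inside [V] or has
    an edge that leaves [V] ([connected_crossing]).  There are at most
    [v * (n - v)] edges that leave [V].  The classes inside [V] share at most
    ['C(v, 2)] edges and have at least [v - 1] edges each, so there are at most
    [v / 2] of them.  Hence [k <= v * (n - v) + v / 2], which is
    [g_ n (v - 1)].

    Both bounds are at the same argument [x = v - 1], so [k] is at most the
    minimum of [f_ n x] and [g_ n x] for this [x], hence at most the maximum over
    all [x].  This maximum exists because only the [x < n] compete for it: the
    minimum is nonnegative for them and [g_ n x <= 0] for the others. *)

(** * Connected sets of edges *)

(** A path in [S] from [T] to a vertex outside [T] has a last vertex before it
    first leaves [T]. *)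
Lemma connected_exit (H : sgraph) (S T : {set H}) :
  induces_connected S -> T \subset S -> T != set0 -> T != S ->
  exists u v, [/\ u \in T, v \in S :\: T & adj u v].
Proof.
case/andP=> _ /forall_inP conn TS /set0Pn[x xT] TneS.
have /subsetPn[y yS yT] : ~~ (S \subset T).
  by apply: contraNN TneS => ST; rewrite eqEsubset TS.
have /forall_inP/(_ y yS)/connectP[p] := conn x (subsetP TS x xT).
elim: p x xT => [|z p IH] x xT /= => [_ yx|/andP[/and3P[xS zS xz] pth] yl].
  by rewrite yx xT in yT.
have [zT|zT] := boolP (z \in T); first exact: IH zT pth yl.
by exists x, z; rewrite inE zT zS.
Qed.

Definition ends (G : sgraph) (e : line_graph G) : {set G} :=
  val (e : {e : {set G} | e \in edges G}).

Lemma ends_inj G : injective (@ends G).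
Proof. exact: val_inj. Qed.

Lemma card_ends G (e : line_graph G) : #|ends e| = 2.
Proof.
have /imsetP[[a b]] : ends e \in edges G.
  exact: valP (e : {e : {set G} | e \in edges G}).
rewrite inE /= => ab ->; rewrite cards2.
by case: eqP ab => // ->; rewrite adj_irr.
Qed.

Lemma ends_meet G (e f : line_graph G) : adj e f -> ends e :&: ends f != set0.
Proof. by case/andP. Qed.

Definition span (G : sgraph) (S : {set line_graph G}) : {set G} :=
  \bigcup_(e in S) ends e.

Lemma ends_sub_span G (S : {set line_graph G}) e :
  e \in S -> ends e \subset span S.
Proof. by move=> eS; apply: (bigcup_sup e). Qed.

(** The inequality between the numbers of vertices and edges of a connected
    graph.  A largest subset [T] of [S] that satisfies it is [S] itself:
    otherwise some edge of [S] outside [T] is incident with [T], and adding it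
    brings at most one new vertex. *)
Lemma card_span (G : sgraph) (S : {set line_graph G}) :
  induces_connected S -> #|span S| <= #|S|.+1.
Proof.
move=> conn; have /andP[/set0Pn[e0 e0S] _] := conn.
pose P (T : {set line_graph G}) :=
  [&& T \subset S, T != set0 & #|span T| <= #|T|.+1].
have P0 : P [set e0].
  rewrite /P sub1set e0S -card_gt0 cards1 /=.
  by rewrite /span big_set1 card_ends.
have [T /maxsetP[/and3P[TS T0 cT] maxT] _] := maxset_exists P0.
have [<- //|TneS] := eqVneq T S.
have [u [v [uT vST uv]]] := connected_exit conn TS T0 TneS.
move: vST; rewrite inE => /andP[vT vS].
suff PvT : P (v |: T).
  by move: vT; rewrite -(maxT _ PvT (subsetUr _ _)) setU11.
rewrite /P subUset sub1set vS TS /= -card_gt0 cardsU1 vT /= add1n.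
rewrite /span big_setU1 //= cardsU card_ends.
have : 0 < #|ends v :&: span T|.
  rewrite card_gt0; have /set0Pn[w] := ends_meet uv.
  rewrite inE => /andP[wu wv]; apply/set0Pn; exists w.
  by rewrite inE wv (subsetP (ends_sub_span uT)).
rewrite -/(span T); move: cT; move: #|span T| #|_ :&: _| #|T| => s i t. lia.
Qed.

Definition crosses (G : sgraph) (V : {set G}) (e : line_graph G) : bool :=
  (ends e :&: V != set0) && ~~ (ends e \subset V).

(** If no edge of [S] crosses [V], the edges of [S] that meet [V] cannot be
    adjacent to the others, so they are all of [S]. *)
Lemma connected_crossing (G : sgraph) (S : {set line_graph G}) (V : {set G}) :
  induces_connected S -> span S :&: V != set0 -> ~~ (span S \subset V) ->
  exists2 e, e \in S & crosses V e.
Proof.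
move=> conn /set0Pn[w]; rewrite inE => /andP[/bigcupP[e eS we] wV] nsub.
apply/exists_inP; apply: contraNT nsub => /exists_inPn nocross.
have inside f : f \in S -> ends f :&: V != set0 -> ends f \subset V.
  by move=> fS fV; have := nocross f fS; rewrite /crosses fV negbK.
pose T := [set f in S | ends f :&: V != set0].
have TS : T \subset S by apply/subsetP=> f; rewrite inE => /andP[].
have T0 : T != set0.
  by apply/set0Pn; exists e; rewrite inE eS; apply/set0Pn; exists w; apply/setIP.
have [eTS|TneS] := eqVneq T S.
  apply/bigcupsP=> f fS; apply: inside => //.
  by move: fS; rewrite -{1}eTS inE => /andP[].
have [u [v []]] := connected_exit conn TS T0 TneS.
rewrite !inE => /andP[uS uV] /andP[vT vS] uv.
have /set0Pn[z /setIP[zu zv]] := ends_meet uv.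
case/negP: vT; rewrite vS; apply/set0Pn; exists z.
by rewrite inE zv (subsetP (inside u uS uV)).
Qed.

(** * Counting colours *)

Lemma card_crosses (G : sgraph) (V : {set G}) :
  #|[set e : line_graph G | crosses V e]| <= #|V| * (#|G| - #|V|).
Proof.
have -> : #|G| - #|V| = #|~: V| by rewrite -(cardsC V) addKn.
rewrite -(card_imset _ (@ends_inj G)) -cardsX.
pose pair (p : G * G) := [set p.1; p.2].
apply: leq_trans (leq_imset_card pair _); apply/subset_leq_card/subsetP=> A.
case/imsetP=> e; rewrite inE => /andP[/set0Pn[a /setIP[ae aV]]].
case/subsetPn=> b be bV ->; apply/imsetP; exists (a, b).
  by rewrite !inE aV.
apply/esym/eqP; rewrite eqEcard subUset !sub1set ae be card_ends cards2 /=.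
by case: eqP bV => // <-; rewrite aV.
Qed.

Lemma card_inside (G : sgraph) (V : {set G}) :
  #|[set e : line_graph G | ends e \subset V]| <= 'C(#|V|, 2).
Proof.
rewrite -(card_imset _ (@ends_inj G)) -cards_draws.
apply/subset_leq_card/subsetP=> A /imsetP[e]; rewrite inE => eV ->.
by rewrite inE eV card_ends /=.
Qed.

Section Colouring.
Variables (G : sgraph) (k : nat) (c : {ffun line_graph G -> 'I_k}).

Definition class (i : 'I_k) : {set line_graph G} := [set e | c e == i].

Hypothesis conn : is_connected_coloring c.

Lemma class_connected i : induces_connected (class i).
Proof. exact: (forallP conn). Qed.

Lemma complete_spans_meet :
  is_complete_coloring c -> forall i j, span (class i) :&: span (class j) != set0.
Proof.
move=> compl i j; have [<-|ij] := eqVneq i j.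
  have /andP[/set0Pn[e ei] _] := class_connected i.
  have := subset_leq_card (ends_sub_span ei).
  by rewrite card_ends setIid -card_gt0; apply: leq_trans.
move/forallP/(_ i)/forallP/(_ j)/implyP/(_ ij): compl.
case/existsP=> e /existsP[f /and3P[ef ei fj]].
have /set0Pn[z /setIP[ze zf]] := ends_meet ef.
apply/set0Pn; exists z; apply/setIP.
by split; apply/bigcupP; [exists e | exists f]; rewrite ?inE.
Qed.

(** Each colour of [B] uses at least [m] of the at most ['C(#|V|, 2)] edges
    inside [V]. *)
Lemma card_colours_inside (V : {set G}) (B : {set 'I_k}) m :
  (forall i, m < #|span (class i)|) ->
  (forall i, i \in B -> span (class i) \subset V) ->
  #|B| * m <= 'C(#|V|, 2).
Proof.
move=> large BV; apply: leq_trans (card_inside V).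
have BE : [set e | c e \in B] \subset [set e : line_graph G | ends e \subset V].
  apply/subsetP=> e; rewrite !inE => /BV; apply: subset_trans.
  by apply: ends_sub_span; rewrite inE.
apply: leq_trans (subset_leq_card BE).
rewrite -sum1dep_card (partition_big c (mem B)) //= -sum_nat_const.
apply: leq_sum => i iB.
rewrite (eq_bigl (mem (class i))) => [|e]; last first.
  by rewrite !inE andbC; case: eqP => // ->; rewrite iB.
by rewrite sum1_card -ltnS; apply: leq_trans (card_span (class_connected i)).
Qed.

(** Distinct colours of [B] have distinct edges that leave [V]. *)
Lemma card_colours_crossing (V : {set G}) (B : {set 'I_k}) :
  (forall i, span (class i) :&: V != set0) ->
  (forall i, i \in B -> ~~ (span (class i) \subset V)) ->
  #|B| <= #|V| * (#|G| - #|V|).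
Proof.
move=> meet out; apply: leq_trans (card_crosses V).
apply: leq_trans (leq_imset_card c _); apply/subset_leq_card/subsetP=> i iB.
have [e] := connected_crossing (class_connected i) (meet i) (out i iB).
by rewrite inE => /eqP ei eV; apply/imsetP; exists e; rewrite ?inE.
Qed.

End Colouring.

(** Here [x.+1] is the size [v] of a smallest span; the second inequality is
    twice the bound [k <= v * (n - v) + v / 2]. *)
Lemma colouring_bounds G k :
  0 < k -> has_connected_complete_coloring (line_graph G) k ->
  exists x, [/\ 0 < x < #|G|, k * x <= 'C(#|G|, 2)
              & k.*2 <= (x.+1 * (#|G| - x.+1)).*2 + x.+1].
Proof.
case: k => // k _ /existsP[c /andP[conn compl]].
have [i0 _ small] := @arg_minnP _ ord0 xpredT (fun i => #|span (class c i)|) isT.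
set V := span (class c i0) in small.
have V2 : 1 < #|V|.
  have /andP[/set0Pn[e ei] _] := class_connected conn i0.
  by have := subset_leq_card (ends_sub_span ei); rewrite card_ends.
have VG : #|V| <= #|G| by apply: max_card.
have large i : #|V|.-1 < #|span (class c i)|.
  by rewrite prednK; [apply: small|apply: ltnW].
have meet i : span (class c i) :&: V != set0.
  exact: complete_spans_meet.
exists #|V|.-1; rewrite prednK ?(ltnW V2) //.
split; first lia.
  have := card_colours_inside conn large (fun i (_ : i \in setT) => subsetT _).
  by rewrite !cardsT card_ord.
pose B := [set i | span (class c i) \subset V].
have inB : #|B| * #|V|.-1 <= 'C(#|V|, 2).
  by apply: (card_colours_inside conn large) => i; rewrite inE.
have outB : #|~: B| <= #|V| * (#|G| - #|V|).
  by apply: (card_colours_crossing conn meet) => i; rewrite !inE.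
have kB : #|B| + #|~: B| = k.+1 by rewrite cardsC card_ord.
have B2 : #|B|.*2 <= #|V|.
  (* Double [inB] and cancel the factor [v - 1], positive since [v >= 2]. *)
  rewrite -(@leq_pmul2r #|V|.-1) -?subn1 ?subn_gt0 // subn1.
  by rewrite -doubleMl -leq_double in inB *; rewrite bin2 in inB; nia.
lia.
Qed.

(** * The maximum of the minimum *)

Local Open Scope ring_scope.

Lemma f_ge0 (n x : nat) : 0 <= f_ n x.
Proof.
rewrite /f_; case: n => [|n]; first by rewrite !mul0r.
by rewrite divr_ge0 ?mulr_ge0 // -natr1 addrK.
Qed.

Lemma min_fg_ge0 (n x : nat) : (x < n)%N -> 0 <= Num.min (f_ n x) (g_ n x).
Proof.
move=> xn; rewrite le_min f_ge0 /g_ mulr_ge0 //; first by rewrite natr1 ler0n.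
have : (x.+1%:R : rat) <= n%:R by rewrite ler_nat.
rewrite -natr1; lra.
Qed.

Lemma min_fg_le0 (n x : nat) : (n <= x)%N -> Num.min (f_ n x) (g_ n x) <= 0.
Proof.
move=> nx; rewrite ge_min /g_; apply/orP; right.
apply: mulr_ge0_le0; first by rewrite natr1 ler0n.
have : (n%:R : rat) <= x%:R by rewrite ler_nat.
lra.
Qed.

Lemma max_min_fg (n : nat) : (1 < n)%N ->
  exists2 x0 : nat, (0 < x0 < n)%N &
    forall x : nat, (0 < x)%N ->
      Num.min (f_ n x) (g_ n x) <= Num.min (f_ n x0) (g_ n x0).
Proof.
move=> n1; pose F (i : 'I_n) := Num.min (f_ n i) (g_ n i).
have [i i0 imax] := @arg_maxP _ _ _ (Ordinal n1) (fun i => (0 < i)%N) F isT.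
exists i => [|x x0]; first by rewrite i0 ltn_ord.
have [xn|nx] := ltnP x n; first exact: (imax (Ordinal xn)).
exact: le_trans (min_fg_le0 nx) (min_fg_ge0 (ltn_ord i)).
Qed.

Lemma le_min_fg (n k x : nat) :
  (0 < x < n)%N -> (k * x <= 'C(n, 2))%N ->
  (k.*2 <= (x.+1 * (n - x.+1)).*2 + x.+1)%N ->
  k%:R <= Num.min (f_ n x) (g_ n x).
Proof.
case/andP=> x0 xn kf kg; rewrite le_min; apply/andP; split.
  rewrite /f_ ler_pdivlMr ?mulr_gt0 ?ltr0n //.
  have : (2 * (k * x) <= n * n.-1)%N by move: kf; rewrite bin2; lia.
  case: n xn {kf kg} => // n _ /=.
  by rewrite -(ler_nat rat) !natrM -[n.+1%:R]natr1 addrK; lra.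
move: kg; rewrite -(ler_nat rat) natrD -!muln2 !natrM natrB // -natr1 /g_.
lra.
Qed.

Unset Implicit Arguments.
Set Strict Implicit.

Theorem theorem1 (n : nat) (hn : (8 <= n)%N) :
  exists M : rat,
    is_max (fun y => exists x : nat, (0 < x)%N /\ y = Num.min (f_ n x) (g_ n x)) M
    /\ ((connected_pseudoachromatic_index (complete_graph n))%:Z <= Num.floor M).
Proof.
have n1 : (1 < n)%N by apply: leq_trans hn.
have [x0 /andP[x0_gt0 x0n] x0max] := max_min_fg n1.
exists (Num.min (f_ n x0) (g_ n x0)); split.
  by split=> [|_ [x [x_gt0 ->]]]; [exists x0 | apply: x0max].
rewrite /connected_pseudoachromatic_index /psi_c.
apply: (big_ind (fun k : nat => k%:Z <= Num.floor _)) => [|a b ha hb|k].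
- by rewrite floor_ge_int ?min_fg_ge0.
- by rewrite /maxn; case: ifP.
case: (posnP k) => [->|k_gt0] col; first by rewrite floor_ge_int min_fg_ge0.
have [x []] := colouring_bounds k_gt0 col.
rewrite card_ord => xn kf kg.
rewrite floor_ge_int; apply: le_trans (x0max x _); last by case/andP: xn.
exact: le_min_fg.
Qed.
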